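(* Let $k$ and $m$ be positive integers. Then $\max\{k+1,2m-1\}$ is the sharp minimum degree threshold guaranteeing a $k$-removable matching of size $m$ without exceptions; that is, $d=\max\{k+1,2m-1\}$ is the smallest integer $d$ such that every $k$-connected graph $G$ with $\delta(G)\ge d$ contains a $k$-removable matching of size $m$.
   Context: All graphs are finite, undirected and simple. $\delta(G)$ is the minimum degree of $G$. A graph is $k$-connected in the usual sense: it has more than $k$ vertices and deleting any set of fewer than $k$ vertices leaves a connected graph. For a $k$-connected graph $G$, a matching $M\subseteq E(G)$ (a set of pairwise vertex-disjoint edges) is called $k$-removable if the graph $G-M$, obtained from $G$ by deleting the edges in $M$ (keeping all vertices), is $k$-connected. The size of a matching is its number of edges. *)

(* Defs.v *)
From mathcomp Require Import all_boot.

Set Implicit Arguments.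
Unset Strict Implicit.
Unset Printing Implicit Defensive.

Record sgraph := SGraph {
  vertex :> finType;
  adj : rel vertex;
  adj_sym : symmetric adj;
  adj_irrefl : irreflexive adj
}.

Definition edges (G : sgraph) : {set {set G}} :=
  [set [set p.1; p.2] | p in [set q : G * G | adj q.1 q.2]].

Definition degree (G : sgraph) (x : G) : nat := #|[set y | adj x y]|.

(* Every degree is smaller than #|G|, so the initial value #|G| is reached
   only by the graph without vertices. *)
Definition min_degree (G : sgraph) : nat :=
  \big[minn/#|G|]_(x : G) degree x.

Section VertexDeletion.
Variables (G : sgraph) (S : {set G}).

Definition del_vertices_adj : rel {x : G | x \notin S} :=
  fun x y => adj (val x) (val y).

Lemma del_vertices_sym : symmetric del_vertices_adj.
Proof. by move=> x y; apply: adj_sym. Qed.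

Lemma del_vertices_irrefl : irreflexive del_vertices_adj.
Proof. by move=> x; apply: adj_irrefl. Qed.

Definition del_vertices : sgraph := SGraph del_vertices_sym del_vertices_irrefl.
End VertexDeletion.

Section EdgeDeletion.
Variables (G : sgraph) (M : {set {set G}}).

Definition del_edges_adj : rel G :=
  fun x y => adj x y && ([set x; y] \notin M).

Lemma del_edges_sym : symmetric del_edges_adj.
Proof. by move=> x y; rewrite /del_edges_adj adj_sym setUC. Qed.

Lemma del_edges_irrefl : irreflexive del_edges_adj.
Proof. by move=> x; rewrite /del_edges_adj adj_irrefl. Qed.

Definition del_edges : sgraph := SGraph del_edges_sym del_edges_irrefl.
End EdgeDeletion.

(* The graph without vertices counts as connected here; this has no effect on
   [k_connected], where at least two vertices remain after the deletion. *)
Definition connected (G : sgraph) : Prop :=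
  forall x y : G, connect (@adj G) x y.

Definition k_connected (k : nat) (G : sgraph) : Prop :=
  k < #|G| /\ forall S : {set G}, #|S| < k -> connected (del_vertices S).

Definition matching (G : sgraph) (M : {set {set G}}) : Prop :=
  M \subset edges G /\ trivIset M.

Definition k_removable (k : nat) (G : sgraph) (M : {set {set G}}) : Prop :=
  matching M /\ k_connected k (del_edges M).

Definition guarantees_removable_matching (k m d : nat) : Prop :=
  forall G : sgraph, k_connected k G -> d <= min_degree G ->
    exists M : {set {set G}}, k_removable k M /\ #|M| = m.

(* Main.v *)
Require Import Defs.
From mathcomp Require Import all_boot zify.

(* Mader's theorem, in a form without cycles: if all vertices of a nonempty set U
   have degree greater than k in a k-connected graph, then some vertex of U has at
   most one neighbour in U along a critical edge, so the critical edges inside U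
   form a forest.  Let M be a k-removable matching of size j, H = G - M and W the
   set of vertices not covered by M, on which H and G have the same degrees.  If
   delta(G) >= 2j + 2, then G[W] has minimum degree at least 2, so it contains an
   edge that is not critical in H, and M can be enlarged.  This reaches size m - 1
   only.  For the last step take j = m - 2, so that G[W] has minimum degree at
   least 3, and suppose that M cannot be enlarged by two edges.  Then deleting the
   two ends of any noncritical edge from W leaves a forest.  The leaves of that
   forest are adjacent to both ends; hence two disjoint noncritical edges force
   |W| = 4.  Otherwise the noncritical edges form a triangle, and counting leaves
   in the forest of critical edges gives |W| = 4 again.  So G = K_2m, where every
   perfect matching is removable.  Sharpness is shown by K_(k+1) and K_(2m-1). *)

Set Implicit Arguments.
Unset Strict Implicit.
Unset Printing Implicit Defensive.

(** * Forests *)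

Section Forests.
Variable T : finType.
Implicit Types (e c n : rel T) (U W : {set T}) (u v w x y z : T).

Definition deg_in e U u := #|[set v in U | e u v]|.

(** For symmetric irreflexive [e] this says that [e] is a forest on [U]: a cycle is a subset without
    such a vertex. *)
Definition acyclic_on e U :=
  forall U', U' \subset U -> U' != set0 -> exists2 u, u \in U' & deg_in e U' u <= 1.

Lemma acyclic_onS e U U' : U' \subset U -> acyclic_on e U -> acyclic_on e U'.
Proof. by move=> sU acU V sV; apply/acU/(subset_trans sV). Qed.

Lemma deg_in_gt1 e U u v w :
  v \in U -> w \in U -> v != w -> e u v -> e u w -> 1 < deg_in e U u.
Proof.
move=> vU wU neq euv euw; apply/card_gt1P; exists v, w.
by rewrite !inE vU wU euv euw.
Qed.

Lemma deg_in_setD1 e U u x : deg_in e U u <= deg_in e (U :\ x) u + e u x.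
Proof.
rewrite /deg_in (cardsD1 x) addnC leq_add //.
  by apply/subset_leq_card/subsetP=> v; rewrite !inE; case: (v == x).
by rewrite !inE; case: (x \in U); case: (e u x).
Qed.

Lemma deg_in_sub e c U u :
  (forall v, v \in U -> e u v -> c u v) -> deg_in e U u <= deg_in c U u.
Proof.
move=> sub; apply/subset_leq_card/subsetP=> v; rewrite !inE.
by case/andP=> vU euv; rewrite vU sub.
Qed.

(** Induction by deleting a low vertex [l]: of two low vertices of [U :\ l], at most one is adjacent
    to [l], and the other stays low in [U]. *)
Lemma acyclic_two_leaves e U :
  symmetric e -> irreflexive e -> acyclic_on e U -> 1 < #|U| ->
  exists u v, [/\ u \in U, v \in U, u != v, deg_in e U u <= 1 & deg_in e U v <= 1].
Proof.
move=> esym eirr; have [N] := ubnP #|U|; elim: N U => // N IH U ltN acU U_gt1.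
have Un0 : U != set0 by rewrite -card_gt0 ltnW.
have [l lU lowl] := acU U (subxx _) Un0.
have cardU : #|U| = (#|U :\ l|).+1 by rewrite (cardsD1 l U) lU.
have lift u : u \in U :\ l -> deg_in e (U :\ l) u + e u l <= 1 ->
    u \in U /\ deg_in e U u <= 1.
  by move=> /setD1P[_ uU] low; split=> //; apply: leq_trans (deg_in_setD1 _ _ _ l) low.
have [U1_gt1 | U1_le1] := ltnP 1 #|U :\ l|; last first.
  have /eqP/cards1P[v Uv] : #|U :\ l| = 1 by lia.
  have vU1 : v \in U :\ l by rewrite Uv set11.
  have [||vU lowv] := lift v => //.
    rewrite Uv /deg_in (_ : [set _ in _ | _] = set0) ?cards0 ?leq_b1 //.
    by apply/setP=> w; rewrite !inE; case: eqP => // ->; rewrite eirr.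
  by exists l, v; split=> //; rewrite eq_sym; case/setD1P: vU1.
have [|u [v [uU1 vU1 neq lowu lowv]]] := IH _ _ (acyclic_onS (subsetDl _ _) acU) U1_gt1.
  by lia.
have [/setD1P[ul uU] /setD1P[vl vU]] := (uU1, vU1).
have [elu|nelu] := boolP (e l u); last first.
  exists l, u; rewrite lU uU eq_sym ul lowl; split=> //.
  by apply: (lift _ uU1 _).2; rewrite esym (negPf nelu) addn0.
have [elv|nelv] := boolP (e l v); last first.
  exists l, v; rewrite lU vU eq_sym vl lowl; split=> //.
  by apply: (lift _ vU1 _).2; rewrite esym (negPf nelv) addn0.
by have := deg_in_gt1 uU vU neq elu elv; rewrite ltnNge lowl.
Qed.

(** * Marked edges whose ends leave a forest when deleted *)

Lemma cardsD2 U x y : x \in U -> y \in U -> x != y -> #|U| = #|U :\ x :\ y| + 2.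
Proof.
by move=> xU yU xy; rewrite (cardsD1 x U) (cardsD1 y) !inE xU yU eq_sym xy !add1n addn2.
Qed.

(* [n] marks the noncritical edges. *)
Section FourVertices.
Variables (e n : rel T) (W : {set T}).
Hypotheses (esym : symmetric e) (eirr : irreflexive e).
Hypotheses (nsym : symmetric n) (nsub : subrel n e).
Hypotheses (Wn0 : W != set0) (deg3 : forall u, u \in W -> 2 < deg_in e W u).
Let c u v := e u v && ~~ n u v.
Hypothesis acW : acyclic_on c W.
Hypothesis acD : forall x y, x \in W -> y \in W -> n x y -> acyclic_on e (W :\ x :\ y).

Let csym : symmetric c. Proof. by move=> u v; rewrite /c esym nsym. Qed.
Let cirr : irreflexive c. Proof. by move=> u; rewrite /c eirr. Qed.

Lemma card_ge4 : 3 < #|W|.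
Proof.
have /set0Pn[u uW] := Wn0; rewrite (cardsD1 u W) uW ltnS.
apply: leq_trans (deg3 uW) _; apply/subset_leq_card/subsetP=> v.
by rewrite !inE => /andP[-> euv]; rewrite andbT; apply: contraTneq euv => ->; rewrite eirr.
Qed.

(** A low vertex of [W :\ x :\ y] is adjacent to [x] and [y], having degree at least three in [W].
    Unless it is [p] or [q], it closes a triangle with [x y] in the forest [W :\ p :\ q]. *)
Lemma disjoint_marked_edges x y p q :
  x \in W -> y \in W -> p \in W -> q \in W -> n x y -> n p q ->
  x != p -> x != q -> y != p -> y != q -> #|W| = 4.
Proof.
move=> xW yW pW qW nxy npq xp xq yp yq.
have [exy epq] := (nsub nxy, nsub npq).
have xy : x != y by apply: contraTneq exy => ->; rewrite eirr.
have pq : p != q by apply: contraTneq epq => ->; rewrite eirr.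
have := cardsD2 xW yW xy; have acU := acD xW yW nxy.
set U := W :\ x :\ y in acU * => cardW.
have low_pq l : l \in U -> deg_in e U l <= 1 -> (l == p) || (l == q).
  rewrite !inE => /and3P[ly lx lW] lowl; apply: contraT; rewrite negb_or => /andP[lp lq].
  have [elx ely] : e l x /\ e l y.
    have := deg3 lW; have := deg_in_setD1 e W l x; have := deg_in_setD1 e (W :\ x) l y.
    by rewrite -/U; move: lowl; case: (e l x); case: (e l y); clear; lia.
  have sV : [set x; y; l] \subset W :\ p :\ q.
    apply/subsetP=> v; rewrite !inE => /orP[/orP[]|] /eqP ->.
    - by rewrite xp xq.
    - by rewrite yp yq.
    - by rewrite lp lq.
  have V0 : [set x; y; l] != set0 by apply/set0Pn; exists x; rewrite !inE eqxx.
  have [v vV] := acD pW qW npq sV V0; rewrite leqNgt => /negP[].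
  move: vV; rewrite !inE => /orP[/orP[]|] /eqP ->.
  - by apply: (@deg_in_gt1 _ _ _ y l); rewrite ?inE ?eqxx ?orbT // 1?eq_sym // esym.
  - by apply: (@deg_in_gt1 _ _ _ x l); rewrite ?inE ?eqxx ?orbT // 1?eq_sym // esym.
  - by apply: (@deg_in_gt1 _ _ _ x y); rewrite ?inE ?eqxx ?orbT.
have U_gt1 : 1 < #|U| by have := card_ge4; rewrite cardW addn2.
have [pU qU] : p \in U /\ q \in U by rewrite !inE pW qW !(eq_sym _ x) !(eq_sym _ y) xp xq yp yq.
(* Two low vertices exist and only [p] and [q] qualify. Being adjacent, they have no other neighbour
   in [U]. *)
have [lowp lowq] : deg_in e U p <= 1 /\ deg_in e U q <= 1.
  have [u [v [uU vU neq lowu lowv]]] := acyclic_two_leaves esym eirr acU U_gt1.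
  move: neq (lowu) (lowv); have /orP[/eqP->|/eqP->] := low_pq u uU lowu;
    by have /orP[/eqP->|/eqP->] := low_pq v vU lowv; rewrite ?eqxx.
have [U'0|U'n0] := eqVneq (U :\ p :\ q) set0.
  by rewrite cardW (cardsD2 pU qU pq) U'0 cards0.
(* A low vertex of the rest would thus be a third low vertex of [U]. *)
have [r rU' lowr] := acU _ (subset_trans (subsetDl _ _) (subsetDl _ _)) U'n0.
have /setD1P[rq /setD1P[rp rU]] := rU'.
have nrp : ~~ e r p.
  apply: contraL lowp => erp; rewrite -ltnNge.
  by apply: (@deg_in_gt1 _ _ _ r q) => //; rewrite esym.
have nrq : ~~ e r q.
  apply: contraL lowq => erp; rewrite -ltnNge.
  by apply: (@deg_in_gt1 _ _ _ r p) => //; rewrite esym.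
have : deg_in e U r <= 1.
  apply: leq_trans (deg_in_setD1 _ _ _ p) _; rewrite (negPf nrp) addn0.
  by apply: leq_trans (deg_in_setD1 _ _ _ q) _; rewrite (negPf nrq) addn0.
by move/(low_pq _ rU); rewrite (negPf rp) (negPf rq).
Qed.

(** Without a marked edge, [e] would agree on [U] with the forest [c]. *)
Lemma ex_marked_edge U : U \subset W -> U != set0 ->
  (forall u, u \in U -> 1 < deg_in e U u) ->
  exists p q, [/\ p \in U, q \in U & n p q].
Proof.
move=> sU Un0 deg2.
have [/existsP[p /existsP[q /and3P[? ? ?]]]|nex] :=
  boolP [exists p, exists q, [&& p \in U, q \in U & n p q]]; first by exists p, q.
have [u uU] := acW sU Un0; rewrite leqNgt => /negP[].
apply: leq_trans (deg2 u uU) _; apply: deg_in_sub => v vU euv; rewrite /c euv /=.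
apply: contra nex => nuv; apply/existsP; exists u; apply/existsP; exists v.
by rewrite uU vU.
Qed.

(** Unless [#|W| = 4], any two marked edges meet. They do not form a star, because [W] minus a
    vertex has minimum degree at least two and so still contains a marked edge. *)
Lemma marked_triangle : #|W| != 4 ->
  exists x y z, [/\ x \in W, y \in W & z \in W] /\ [/\ n x y, n y z & n x z].
Proof.
move=> W4.
have meet x y p q : x \in W -> y \in W -> p \in W -> q \in W -> n x y -> n p q ->
    [|| x == p, x == q, y == p | y == q].
  move=> xW yW pW qW nxy npq; apply: contraNT W4; rewrite !negb_or => /and4P[*].
  by apply/eqP; apply: (@disjoint_marked_edges x y p q).
have W1n0 x : W :\ x != set0.
  rewrite -card_gt0; have := card_ge4; rewrite (cardsD1 x W); case: (x \in W) => /=; lia.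
have deg2 x u : u \in W :\ x -> 1 < deg_in e (W :\ x) u.
  case/setD1P=> _ uW; have := deg3 uW; have := deg_in_setD1 e W u x.
  by case: (e u x); lia.
have [x [y [xW yW nxy]]] : exists p q, [/\ p \in W, q \in W & n p q].
  by apply: ex_marked_edge => // u uW; apply: ltnW (deg3 uW).
have [z [zW zx nyz]] : exists z, [/\ z \in W, z != x & n y z].
  have [p [q [/setD1P[px pW] /setD1P[qx qW] npq]]] :=
    ex_marked_edge (subsetDl _ _) (W1n0 x) (deg2 x).
  have := meet _ _ _ _ xW yW pW qW nxy npq.
  rewrite !(eq_sym x) (negPf px) (negPf qx) /= => /orP[]/eqP yE.
    by exists q; rewrite yE.
  by exists p; rewrite yE nsym.
exists x, y, z; split=> //; split=> //.
have [p [q [/setD1P[py pW] /setD1P[qy qW] npq]]] :=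
  ex_marked_edge (subsetDl _ _) (W1n0 y) (deg2 y).
have := meet _ _ _ _ yW zW pW qW nyz npq; have := meet _ _ _ _ xW yW pW qW nxy npq.
rewrite !(eq_sym y) (negPf py) (negPf qy) /= orbF => /orP[]/eqP xE /orP[]/eqP zE;
  move: npq zx; rewrite -?xE -?zE ?eqxx //.
- by move=> _; rewrite zE xE eqxx.
- by rewrite nsym.
- by move=> _; rewrite zE xE eqxx.
Qed.

Lemma card4_of_marked_acyclic : #|W| = 4.
Proof.
apply/eqP/contraT=> W4; have [x [y [z [[xW yW zW] [nxy nyz nxz]]]]] := marked_triangle W4.
have neq u v : n u v -> u != v by move/nsub; apply: contraTneq => ->; rewrite eirr.
have [xy yz xz] := And3 (neq _ _ nxy) (neq _ _ nyz) (neq _ _ nxz).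
(* A marked edge with an end outside the triangle would be disjoint from one of the triangle's
   edges. *)
have c_e u v : u \in W -> v \in W -> u != x -> u != y -> u != z -> c u v = e u v.
  move=> uW vW ux uy uz; rewrite /c; case nuv: (n u v); rewrite ?andbT //.
  case/negP: W4; have [ux' uy' uz'] := And3 ux uy uz; move: ux' uy' uz'.
  rewrite eq_sym => xu; rewrite eq_sym => yu; rewrite eq_sym => zu.
  have [vx|vx] := eqVneq v x.
    by rewrite (@disjoint_marked_edges y z u v) // ?vx // eq_sym.
  have [vy|vy] := eqVneq v y.
    by rewrite (@disjoint_marked_edges x z u v) // ?vy // eq_sym.
  by rewrite (@disjoint_marked_edges x y u v) // eq_sym.
(* A vertex outside the triangle keeps degree at least two in [W :\ d], so the two low vertices of
   the forest [c] there are [a] and [b]. *)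
have lowD a b d : a \in W -> b \in W -> d \in W -> [set a; b; d] = [set x; y; z] ->
    a != b -> a != d -> b != d -> deg_in c (W :\ d) a <= 1.
  move=> aW bW dW E ab ad bd.
  have W1_gt1 : 1 < #|W :\ d| by have := card_ge4; rewrite (cardsD1 d W) dW ltnS => /ltnW.
  have low_ab u : u \in W :\ d -> deg_in c (W :\ d) u <= 1 -> (u == a) || (u == b).
    case/setD1P=> ud uW; apply: contraLR; rewrite negb_or -ltnNge => /andP[ua ub].
    have : u \notin [set x; y; z] by rewrite -E !inE negb_or ud negb_or ua ub.
    rewrite !inE !negb_or -andbA => /and3P[ux uy uz].
    have : deg_in e (W :\ d) u <= deg_in c (W :\ d) u.
      by apply: deg_in_sub => v /setD1P[_ vW]; rewrite c_e.
    by have := deg3 uW; have := deg_in_setD1 e W u d; case: (e u d); clear; lia.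
  have [u [v [uU vU uv lowu lowv]]] :=
    acyclic_two_leaves csym cirr (acyclic_onS (subsetDl _ [set d]) acW) W1_gt1.
  move: uv (lowu) (lowv); have /orP[/eqP->|/eqP->] := low_ab u uU lowu;
    by have /orP[/eqP->|/eqP->] := low_ab v vU lowv; rewrite ?eqxx.
have lowx : deg_in c (W :\ z) x <= 1 by apply: (lowD x y z).
have lowy : deg_in c (W :\ z) y <= 1.
  by apply: (lowD y x z) => //; rewrite 1?(setUC [set y]) // eq_sym.
have lowz : deg_in c (W :\ x) z <= 1.
  by apply: (lowD z y x) => //; rewrite 1?eq_sym //; apply/setP=> w; rewrite !inE; do 3 case: eqP.
pose U := W :\ x :\ y :\ z.
have U_gt1 : 1 < #|U|.
  have := card_ge4; have : #|W| != 4 by [].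
  rewrite (cardsD1 x W) (cardsD1 y (W :\ x)) (cardsD1 z (W :\ x :\ y)) -/U.
  by rewrite !inE xW yW zW (eq_sym z x) (eq_sym z y) (eq_sym y x) xy xz yz /=; clear; lia.
have sU : U \subset W by do 2 apply: subset_trans (subsetDl _ _) _; apply: subsetDl.
have [u [v [uU vU uv lowu lowv]]] :=
  acyclic_two_leaves csym cirr (acyclic_onS sU acW) U_gt1.
(* Of the at least three edges at [t], at most one stays inside [U]. *)
have two t : t \in U -> deg_in c U t <= 1 -> 1 < c x t + c y t + c z t.
  rewrite !inE => /and4P[tz ty tx tW] lowt.
  rewrite !(csym _ t) !c_e //.
  have : deg_in e U t <= deg_in c U t.
    by apply: deg_in_sub => w /(subsetP sU) wW; rewrite c_e.
  have := deg3 tW; have := deg_in_setD1 e W t x.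
  have := deg_in_setD1 e (W :\ x) t y; have := deg_in_setD1 e (W :\ x :\ y) t z.
  by rewrite -/U; move: lowt; case: (e t x); case: (e t y); case: (e t z); clear; lia.
have no2 t d : deg_in c (W :\ d) t <= 1 -> d \in [set x; y; z] -> ~~ (c t u && c t v).
  move=> lowt dE; apply: contraL lowt => /andP[ctu ctv]; rewrite -ltnNge.
  move: uU vU; rewrite !inE => /and4P[uz uy ux uW] /and4P[vz vy vx vW].
  apply: deg_in_gt1 uv ctu ctv; rewrite !inE ?uW ?vW andbT;
    by move: dE; rewrite !inE => /orP[/orP[]|]/eqP->.
(* [u] and [v] together send at least four critical edges to the triangle, but each of its three
   vertices receives at most one of them. *)
have := no2 x z lowx; have := no2 y z lowy; have := no2 z x lowz.
rewrite !inE !eqxx !orbT => /(_ isT) + /(_ isT) + /(_ isT).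
have := two u uU lowu; have := two v vU lowv.
by case: (c x u); case: (c x v); case: (c y u); case: (c y v); case: (c z u); case: (c z v).
Qed.

End FourVertices.
End Forests.

(** * Mader's theorem on critical edges *)

Section Mader.
Variable T : finType.
Implicit Types (e : rel T) (A B U : {set T}) (x y z : T).

Definition anticomplete e A B := [forall a in A, forall b in B, ~~ e a b].

(* [~: (A :|: B)] is the separator between the sides [A] and [B]. *)
Definition kconn k e := (k < #|T|) &&
  [forall A : {set T}, forall B : {set T},
    [&& A != set0, B != set0, [disjoint A & B] & anticomplete e A B] ==>
    (k <= #|~: (A :|: B)|)].

Lemma kconnP k e :
  reflect (k < #|T| /\ forall A B x y, x \in A -> y \in B -> [disjoint A & B] ->
             {in A & B, forall a b, ~~ e a b} -> k <= #|~: (A :|: B)|)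
          (kconn k e).
Proof.
apply: (iffP andP) => -[kT H]; split=> //.
  move=> A B x y xA yB dAB acAB; move/forallP/(_ A)/forallP/(_ B)/implyP: H; apply.
  apply/and4P; split=> //; [by apply/set0Pn; exists x | by apply/set0Pn; exists y |].
  by apply/forall_inP=> a aA; apply/forall_inP=> b bB; apply: acAB.
apply/forallP=> A; apply/forallP=> B; apply/implyP=> /and4P[/set0Pn[x xA] /set0Pn[y yB] dAB ac].
apply: (H A B x y) => // a b aA bB.
by move/forall_inP/(_ a aA)/forall_inP/(_ b bB): ac.
Qed.

Lemma eq_kconn k e e' : e =2 e' -> kconn k e = kconn k e'.
Proof.
move=> E; apply/kconnP/kconnP=> -[kT H]; split=> // A B x y xA yB dAB ac;
  by apply: (H A B x y) => // a b aA bB; have := ac a b aA bB; rewrite E.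
Qed.

Definition del_edge e x y : rel T := fun a b => e a b && ([set a; b] != [set x; y]).

Definition critical k e x y := e x y && ~~ kconn k (del_edge e x y).

Lemma critical_sym k e : symmetric e -> symmetric (critical k e).
Proof.
move=> esym x y; rewrite /critical esym (@eq_kconn k _ (del_edge e y x)) // => a b.
by rewrite /del_edge (setUC [set x]).
Qed.

(** Witnesses that an edge [x y] is critical: no other edge joins the sides, and fewer than [k]
    vertices lie outside them. *)
Definition edge_separation k e x y A B :=
  [&& x \in A, y \in B, [disjoint A & B], #|~: (A :|: B)| < k &
      [forall a in A, forall b in B, e a b ==> (a == x) && (b == y)]].

Lemma edge_separationC k e x y A B : symmetric e ->
  edge_separation k e x y A B -> edge_separation k e y x B A.
Proof.
move=> esym /and5P[xA yB dAB lt /forall_inP ac]; apply/and5P; split=> //.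
- by rewrite disjoint_sym.
- by rewrite setUC.
apply/forall_inP=> b bB; apply/forall_inP=> a aA; rewrite esym andbC.
by move/forall_inP/(_ b bB): (ac a aA).
Qed.

Lemma edge_separation_uniq k e x y A B a b : edge_separation k e x y A B ->
  a \in A -> b \in B -> e a b -> a = x /\ b = y.
Proof.
case/and5P=> _ _ _ _ /forall_inP ac aA bB eab.
by move/forall_inP/(_ b bB)/implyP/(_ eab)/andP: (ac a aA) => [/eqP ? /eqP ?].
Qed.

(** A small separation of the graph without [x y] is crossed by an edge of the k-connected graph
    [e], which can only be [x y]; the sides are swapped if necessary. *)
Lemma critical_separation k e x y : symmetric e -> kconn k e -> critical k e x y ->
  exists A B, edge_separation k e x y A B.
Proof.
move=> esym /kconnP[kT conn] /andP[exy]; rewrite negb_and kT /=.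
case/forallPn=> A /forallPn[B]; rewrite negb_imply -ltnNge.
case/andP=> /and4P[/set0Pn[u uA] /set0Pn[v vB] dAB /forall_inP ac] lt.
have ends a b : a \in A -> b \in B -> e a b -> a = x /\ b = y \/ a = y /\ b = x.
  move=> aA bB eab; have /forall_inP/(_ b bB) := ac a aA.
  rewrite /del_edge eab /= negbK => /eqP E.
  have ab : a != b by apply: contraTneq aA => ->; rewrite (disjointFl dAB bB).
  have : a \in [set x; y] by rewrite -E set21.
  have : b \in [set x; y] by rewrite -E set22.
  rewrite !inE => /orP[]/eqP bE /orP[]/eqP aE; move: ab; rewrite aE bE ?eqxx //; auto.
have [/existsP[a /existsP[b /and3P[aA bB eab]]]|nex] :=
    boolP [exists a, exists b, [&& a \in A, b \in B & e a b]]; last first.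
  suff : k <= #|~: (A :|: B)| by rewrite leqNgt lt.
  apply: (conn A B u v) => // a b aA bB.
  apply: contra nex => eab; apply/existsP; exists a; apply/existsP; exists b.
  by rewrite aA bB.
have [[ax byE]|[ay bxE]] := ends a b aA bB eab; subst.
  exists A, B; rewrite /edge_separation aA bB dAB lt /=.
  apply/forall_inP=> a' a'A; apply/forall_inP=> b' b'B; apply/implyP=> e'.
  have [[-> ->]|[a'E b'E]] := ends a' b' a'A b'B e'; rewrite ?eqxx //.
  by subst; rewrite (disjointFr dAB) in bB.
exists B, A; apply: edge_separationC => //.
rewrite /edge_separation aA bB dAB lt /=.
apply/forall_inP=> a' a'A; apply/forall_inP=> b' b'B; apply/implyP=> e'.
have [[a'E b'E]|[-> ->]] := ends a' b' a'A b'B e'; rewrite ?eqxx //.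
by subst; rewrite (disjointFr dAB) in bB.
Qed.

(* Uncrossing: a corner of two crossing separations with less than [k - 1]
   boundary vertices is [x] alone, and then [x] has degree at most [k]. *)
Lemma small_corner k e x y z A B A' B' : irreflexive e -> kconn k e ->
  edge_separation k e x y A B -> edge_separation k e x z A' B' ->
  #|~: ((A :&: A') :|: (B :|: B'))| + 1 < k -> #|[set v | e x v]| <= k.
Proof.
move=> eirr /kconnP[_ conn] sep sep' ltk.
have uniq := edge_separation_uniq sep; have uniq' := edge_separation_uniq sep'.
have /and5P[xA yB dAB _ _] := sep; have /and5P[xA' zB' dAB' _ _] := sep'.
set S := ~: _ in ltk.
(* Any further vertices of the corner would be cut off from [B :|: B'] by [S] and [x], fewer than
   [k] vertices. *)
have corner w : w \in A -> w \in A' -> w = x.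
  move=> wA wA'; apply/eqP/contraT=> wx.
  have := conn (A :&: A' :\ x) (B :|: B') w y.
  rewrite !inE wx wA wA' yB => /(_ isT isT) H.
  suff : k <= #|S| + 1 by lia.
  apply: leq_trans (H _ _) _.
  - rewrite -setI_eq0; apply/eqP/setP=> t; rewrite !inE.
    apply/negP=> /andP[/and3P[_ tA tA'] /orP[tB|tB]].
      by rewrite (disjointFr dAB) in tB.
    by rewrite (disjointFr dAB') in tB.
  - move=> a b; rewrite !inE => /and3P[ax aA aA'] /orP[bB|bB].
      by apply: contra ax => eab; have [->] := uniq _ _ aA bB eab.
    by apply: contra ax => eab; have [->] := uniq' _ _ aA' bB eab.
  - rewrite -(cards1 x); apply: leq_trans (leq_card_setU _ _).
    apply/subset_leq_card/subsetP=> t; rewrite !inE !negb_or !negb_and negbK.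
    by case: (t == x); rewrite ?orbT ?orbF.
(* The only neighbour of [x] in [B] is [y], the only one in [B'] is [z], and all others lie in
   [S]. *)
apply: leq_trans (_ : #|S :|: [set y; z]| <= k); last first.
  apply: leq_trans (leq_card_setU _ _) _; rewrite cards2; case: (y != z); lia.
apply/subset_leq_card/subsetP=> v; rewrite !inE => exv.
have [vB|vB] := boolP (v \in B).
  by have [_ ->] := uniq _ _ xA vB exv; rewrite eqxx orbT.
have [vB'|vB'] := boolP (v \in B').
  by have [_ ->] := uniq' _ _ xA' vB' exv; rewrite eqxx !orbT.
have [vA|vA] := boolP (v \in A); rewrite //= ?orbF.
have [vA'|vA'] := boolP (v \in A'); rewrite //= ?orbF.
by rewrite (corner v) // eirr in exv.
Qed.

Lemma card_indicator A : #|A| = \sum_(t : T) (t \in A).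
Proof. by rewrite -sum1_card big_mkcond; apply: eq_bigr => t _; case: ifP. Qed.

(* Take the separation of a critical edge inside [U] whose side [A] is smallest and
   uncross it with a separation of a second critical edge at the same vertex of [A]. *)
Theorem mader k e U : symmetric e -> irreflexive e -> kconn k e -> U != set0 ->
  (forall u, u \in U -> k < #|[set v | e u v]|) ->
  exists2 u, u \in U & #|[set v in U | critical k e u v]| <= 1.
Proof.
move=> esym eirr kc /set0Pn[u0 u0U] deg; apply/exists_inP/contraT.
rewrite negb_exists => /forallP two.
have crit2 x : x \in U ->
    exists y z, [/\ y \in U, z \in U, y != z, critical k e x y & critical k e x z].
  move=> xU; have := two x; rewrite xU -ltnNge => /card_gt1P[y [z [+ + neq]]].
  by rewrite !inE => /andP[yU cy] /andP[zU cz]; exists y, z.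
pose good s := [exists x in U, exists y in U, exists A : {set T}, exists B : {set T},
  edge_separation k e x y A B && (#|A| == s)].
have goodI x y A B : x \in U -> y \in U -> edge_separation k e x y A B -> good #|A|.
  move=> xU yU sep; apply/exists_inP; exists x => //; apply/exists_inP; exists y => //.
  by apply/existsP; exists A; apply/existsP; exists B; rewrite sep eqxx.
have ex_good : exists s, good s.
  have [y [_ [yU _ _ cy _]]] := crit2 _ u0U.
  have [A [B sep]] := critical_separation esym kc cy.
  by exists #|A|; apply: goodI sep.
case: (ex_minnP ex_good) => s /exists_inP[x xU /exists_inP[y yU]].
case/existsP=> A /existsP[B /andP[sep /eqP <-]] minA {s ex_good}.
have [z [zU yz cz]] : exists z, [/\ z \in U, z != y & critical k e x z].
  have [z1 [z2 [z1U z2U neq c1 c2]]] := crit2 _ xU.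
  have [z1y|] := eqVneq z1 y; last by exists z1.
  by exists z2; rewrite -z1y eq_sym.
have [A' [B' sep']] := critical_separation esym kc cz.
(* [B'] is the first side of a separation for [z x], so the minimality of [A] applies to it. *)
have leB' : #|A| <= #|B'| by apply: minA; apply: (goodI z x) (edge_separationC esym sep').
have uniq := edge_separation_uniq sep; have uniq' := edge_separation_uniq sep'.
have /and5P[xA yB dAB ltS _] := sep; have /and5P[xA' zB' dAB' ltS' _] := sep'.
have := deg x xU; rewrite ltnNge => /negP[]; apply: (small_corner eirr kc sep sep').
set S := ~: _.
have [/set0Pn[w /setIP[wB wB']]|] := boolP (B :&: B' != set0).
  (* An edge from this corner to [A :|: A'] would be both [x y] and [x z]. *)
  have le2 : k <= #|~: ((B :&: B') :|: (A :|: A'))|.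
    have /kconnP[_ conn] := kc; apply: (conn _ _ w x); rewrite ?inE ?wB ?xA //.
      rewrite -setI_eq0; apply/eqP/setP=> t; rewrite !inE.
      apply/negP=> /andP[/andP[tB tB'] /orP[tA|tA]].
        by rewrite (disjointFl dAB) in tA.
      by rewrite (disjointFl dAB') in tA.
    move=> b a; rewrite !inE => /andP[bB bB'] /orP[aA|aA]; rewrite esym; apply/negP=> eab.
      have [_ bE] := uniq _ _ aA bB eab.
      have [aE _] := uniq _ _ aA bB eab; rewrite aE in eab.
      have [_ bE'] := uniq' _ _ xA' bB' eab.
      by rewrite -bE -bE' eqxx in yz.
    have [aE bE] := uniq' _ _ aA bB' eab; rewrite aE in eab.
    have [_ bE'] := uniq _ _ xA bB eab.
    by rewrite -bE -bE' eqxx in yz.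
  (* Submodularity: the two corner boundaries have at most [2(k - 1)] vertices in total, which
     leaves at most [k - 2] for [S]. *)
  suff : #|S| + #|~: ((B :&: B') :|: (A :|: A'))| <= #|~: (A :|: B)| + #|~: (A' :|: B')|.
    move: le2 ltS ltS'; move: #|S| #|~: (A :|: B)| #|~: (A' :|: B')| #|~: (_ :|: _)|.
    by clear; lia.
  rewrite !card_indicator -!big_split; apply: leq_sum => t _ /=; rewrite !inE.
  have := disjointFr dAB (x := t); have := disjointFr dAB' (x := t).
  by case: (t \in A); case: (t \in A'); case: (t \in B); case: (t \in B') => //= H1 H2;
    have := H1 isT; have := H2 isT.
rewrite negbK => /eqP BB'0.
(* The three sets on the left are disjoint and avoid [B]. Since [A] is no larger than [B'] and [x]
   lies in [A :&: A'], [S] is smaller than the separator of [A] and [B]. *)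
suff : #|S| + #|B'| + #|A :&: A'| <= #|~: (A :|: B)| + #|A|.
  have : 0 < #|A :&: A'| by apply/card_gt0P; exists x; rewrite inE xA.
  move: ltS leB'; move: #|S| #|~: (A :|: B)| #|A| #|B'| #|A :&: A'|.
  by clear; lia.
rewrite !card_indicator -!big_split; apply: leq_sum => t _ /=; rewrite !inE.
have := disjointFr dAB (x := t); have := disjointFr dAB' (x := t).
have /setP/(_ t) := BB'0; rewrite !inE.
by case: (t \in A); case: (t \in A'); case: (t \in B); case: (t \in B') => //= H0 H1 H2;
  (have := H1 isT) || (have := H2 isT).
Qed.

End Mader.

(** * Removable matchings *)

Lemma min_degree_le (G : sgraph) (x : G) : min_degree G <= degree x.
Proof.
rewrite /min_degree; have := mem_index_enum x.
elim: (index_enum G) => // y s IH; rewrite inE big_cons geq_min.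
by case/orP=> [/eqP->|/IH->]; rewrite ?leqnn ?orbT.
Qed.

Lemma min_degree_card (G : sgraph) : min_degree G <= #|G|.
Proof.
rewrite /min_degree; elim/big_rec: _ => // x a _ aG.
by rewrite geq_min aG orbT.
Qed.

Lemma min_degree_ge (G : sgraph) d :
  d <= #|G| -> (forall x : G, d <= degree x) -> d <= min_degree G.
Proof.
move=> dG dx; rewrite /min_degree; elim/big_ind: _ => // a b da db.
by rewrite leq_min da.
Qed.

Lemma adj_neq (G : sgraph) (x y : G) : adj x y -> x != y.
Proof. by apply: contraTneq => ->; rewrite adj_irrefl. Qed.

Lemma degree_lt_card (G : sgraph) (x : G) : degree x < #|G|.
Proof.
rewrite -cardsT (cardsD1 x) inE add1n ltnS; apply/subset_leq_card/subsetP=> y.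
by rewrite !inE andbT eq_sym => /adj_neq.
Qed.

(** If deleting [S] disconnects [x] from [y], the component of [x] and the remaining vertices are
    the sides of a separation. Conversely, a path that avoids the separator cannot leave [A]. *)
Lemma k_connectedP k (G : sgraph) : reflect (k_connected k G) (kconn k (@adj G)).
Proof.
apply: (iffP (kconnP _ _)) => -[kG conn]; split=> //.
  move=> S ltS x y; apply: contraTT ltS => nxy; rewrite -leqNgt.
  pose A := [set val z | z in connect (@adj (del_vertices S)) x].
  have Aval z : (val z \in A) = connect (@adj (del_vertices S)) x z.
    by rewrite mem_imset //; apply: val_inj.
  have AS a : a \in A -> a \notin S by case/imsetP=> z _ ->; exact: (valP z).
  apply: leq_trans (conn A (~: (A :|: S)) (val x) (val y) _ _ _ _) _.
  - by rewrite Aval connect0.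
  - by rewrite !inE Aval (negPf nxy) (valP y).
  - by rewrite -setI_eq0; apply/eqP/setP=> t; rewrite !inE; case: (t \in A).
  - move=> a b aA; rewrite !inE negb_or => /andP[bA bS].
    case/imsetP: aA => a' xa' ->; apply: contra bA => ab.
    pose b' : del_vertices S := Sub b bS.
    have -> : b = val b' by rewrite SubK.
    rewrite Aval; apply: connect_trans (xa' : connect _ x a') (connect1 _).
    by rewrite /adj /= /del_vertices_adj SubK.
  - apply/subset_leq_card/subsetP=> t; rewrite !inE negb_or negbK.
    by case/andP=> /negPf->.
move=> A B x y xA yB dAB ac; rewrite leqNgt; apply/negP=> lt.
have xS : x \notin ~: (A :|: B) by rewrite !inE xA.
have yS : y \notin ~: (A :|: B) by rewrite !inE yB orbT.
have /connectP[p] := conn _ lt (Sub x xS) (Sub y yS).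
have : val (Sub x xS : del_vertices (~: (A :|: B))) \in A by rewrite SubK.
elim: p (Sub x xS) => [|z p IH] w /=.
  move=> wA _ yE; have yw : y = val w by rewrite -yE.
  by rewrite yw (disjointFr dAB wA) in yB.
move=> wA /andP[wz pth] last_y; apply: (IH z) => //.
have := valP z; rewrite !inE negbK => /orP[] // zB.
by move: (ac _ _ wA zB); rewrite (wz : adj (val w) (val z)).
Qed.

(** * Matchings and their uncovered vertices *)

Section Matchings.
Variables (k : nat) (G : sgraph).
Implicit Types (M : {set {set G}}) (U : {set G}) (x y : G).

Lemma edgesP (E : {set G}) :
  reflect (exists x y, adj x y /\ E = [set x; y]) (E \in edges G).
Proof.
apply: (iffP imsetP) => [[[x y]]|[x [y [xy ->]]]].
  by rewrite inE /= => xy ->; exists x, y.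
by exists (x, y); rewrite ?inE.
Qed.

Lemma card_cover_matching M : matching M -> #|cover M| = 2 * #|M|.
Proof.
case=> sM /eqP <-; rewrite mulnC -sum_nat_const; apply: eq_bigr => E EM.
have /edgesP[x [y [xy ->]]] := subsetP sM E EM.
by rewrite cards2 adj_neq.
Qed.

Lemma matching_setU1 M x y : matching M -> adj x y ->
  x \notin cover M -> y \notin cover M ->
  matching ([set x; y] |: M) /\ #|[set x; y] |: M| = #|M|.+1.
Proof.
move=> [sM tM] xy xM yM.
have M0 : set0 \notin M.
  apply/negP=> /(subsetP sM)/edgesP[a [b [_ /setP/(_ a)]]].
  by rewrite !inE eqxx.
have [|tM' nM] := @trivIsetU1 _ [set x; y] M _ tM M0.
  move=> E EM; rewrite -setI_eq0; apply/eqP/setP=> t; rewrite !inE.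
  apply/negP=> /andP[/orP[]/eqP-> tE].
    by case/negP: xM; apply/bigcupP; exists E.
  by case/negP: yM; apply/bigcupP; exists E.
split; last by rewrite cardsU1 nM.
by split=> //; rewrite subUset sM andbT sub1set; apply/edgesP; exists x, y.
Qed.

Lemma cover_setU1 M x y t :
  (t \notin cover ([set x; y] |: M)) = [&& t != x, t != y & t \notin cover M].
Proof. by rewrite /cover bigcup_setU big_set1 !inE !negb_or andbA. Qed.

Lemma matching_mate M x y z : matching M ->
  [set x; y] \in M -> [set z; y] \in M -> z != y -> z = x.
Proof.
move=> [_ /trivIsetP tM] xyM zyM zy; apply/eqP.
have /eqP/setP/(_ z) : [set x; y] == [set z; y].
  apply/contraT => /(tM _ _ xyM zyM)/disjointFr/(_ (set22 x y)).
  by rewrite set22.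
by rewrite !inE eqxx (negPf zy) orbF.
Qed.

Lemma del_edges_setU1 M x y :
  del_edge (@adj (del_edges M)) x y =2 @adj (del_edges ([set x; y] |: M)).
Proof.
by move=> a b; rewrite /del_edge /= /del_edges_adj !inE negb_or -andbA [X in _ && X]andbC.
Qed.

Lemma adj_del_edges M x y : x \notin cover M -> @adj (del_edges M) x y = adj x y.
Proof.
move=> xM; rewrite /= /del_edges_adj andbC; case: (boolP (_ \in M)) => // EM.
by case/negP: xM; apply/bigcupP; exists [set x; y] => //; rewrite set21.
Qed.

Lemma deg_in_uncovered M x : min_degree G <= deg_in (@adj G) (~: cover M) x + #|cover M|.
Proof.
apply: leq_trans (min_degree_le x) _; apply: leq_trans (leq_card_setU _ _).
by apply/subset_leq_card/subsetP=> y; rewrite !inE => ->; case: (y \in _).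
Qed.

Lemma uncovered_n0 M : #|cover M| < min_degree G -> ~: cover M != set0.
Proof.
move=> ltM; have := leq_trans ltM (min_degree_card G).
by rewrite -card_gt0 -(cardsC (cover M)) -[X in X < _]addn0 ltn_add2l.
Qed.

(** Every pair across a separation of [G - M] is an edge of [M], so a third vertex on the sides
    would give [x] or [y] two mates. *)
Lemma complete_removable M : (forall x y, x != y -> adj x y) -> k.+1 < #|G| ->
  matching M -> k_removable k M.
Proof.
move=> full kG mM; split=> //; apply/k_connectedP/kconnP; split; first exact: ltnW.
move=> A B x y xA yB dAB ac; rewrite leqNgt; apply/negP=> lt.
have sep a b : a \in A -> b \in B -> a != b /\ [set a; b] \in M.
  move=> aA bB; have ab : a != b by apply: contraTneq aA => ->; rewrite (disjointFl dAB bB).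
  by split=> //; have := ac a b aA bB; rewrite /= /del_edges_adj full // negbK.
have [xy xyM] := sep x y xA yB.
(* Fewer than [k] of the at least [k + 2] vertices lie outside the sides. *)
have /set0Pn[z] : (A :|: B) :\ x :\ y != set0.
  rewrite -card_gt0; have := cardsC (A :|: B).
  rewrite (@cardsD2 _ (A :|: B) x y) ?inE ?xA ?yB ?orbT //.
  have : #|G| = #|[set: G]| by rewrite cardsT.
  move: lt kG; move: #|~: (A :|: B)| #|_ :\ y| #|G| #|[set: G]|; clear; lia.
rewrite !inE => /and3P[zy zx /orP[zA|zB]].
  have [_ zyM] := sep z y zA yB.
  by rewrite (matching_mate mM xyM zyM zy) eqxx in zx.
have [_ xzM] := sep x z xA zB.
rewrite setUC in xyM; rewrite setUC in xzM.
by rewrite (matching_mate mM xyM xzM zx) eqxx in zy.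
Qed.

Lemma complete_of_min_degree : #|G| <= (min_degree G).+1 ->
  forall x y, x != y -> adj x y.
Proof.
move=> leG x y xy; have /setP/(_ y) : [set z | adj x z] = [set~ x].
  apply/eqP; rewrite eqEcard cardsC1; apply/andP; split.
    by apply/subsetP=> z; rewrite !inE eq_sym => /adj_neq.
  by rewrite -subn1 leq_subLR add1n; apply: leq_trans leG _; apply: (min_degree_le x).
by rewrite !inE eq_sym xy.
Qed.

(** * Enlarging a removable matching *)

Hypothesis deg_k : k < min_degree G.

(** Intended for uncovered ends, where adjacency in [G] and in [G - M] agree. *)
Definition removable_edge M x y := adj x y && ~~ critical k (@adj (del_edges M)) x y.

(** Uncovered vertices keep their degree, which exceeds [k], in [G - M]; Mader's theorem applies to
    each nonempty set of them. *)
Lemma removable_acyclic M : k_removable k M ->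
  acyclic_on (fun x y => adj x y && ~~ removable_edge M x y) (~: cover M).
Proof.
move=> [_ /k_connectedP kc] U sU Un0.
have [|u uU lowu] := mader (@adj_sym _) (@adj_irrefl _) kc Un0.
  move=> u /(subsetP sU); rewrite inE => uM.
  apply: leq_trans deg_k _; apply: leq_trans (@min_degree_le G u) _.
  by apply/subset_leq_card/subsetP=> v; rewrite !inE adj_del_edges.
exists u => //; apply: leq_trans (deg_in_sub _) lowu => v _.
by rewrite /removable_edge => /andP[->]; rewrite negbK.
Qed.

Lemma removable_setU1 M x y : k_removable k M -> x \notin cover M -> y \notin cover M ->
  removable_edge M x y ->
  k_removable k ([set x; y] |: M) /\ #|[set x; y] |: M| = #|M|.+1.
Proof.
move=> [mM _] xM yM /andP[xy]; rewrite /critical adj_del_edges // xy negbK => kc.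
have [mM' cM'] := matching_setU1 mM xy xM yM; split=> //; split=> //.
by apply/k_connectedP; rewrite -(eq_kconn _ (@del_edges_setU1 M x y)).
Qed.

Lemma acyclic_of_no_removable_edge M U : k_removable k M -> U \subset ~: cover M ->
  (forall x y, x \in U -> y \in U -> ~~ removable_edge M x y) -> acyclic_on (@adj G) U.
Proof.
move=> rM sU stuck U' sU' U'n0.
have [u uU' low] := removable_acyclic rM (subset_trans sU' sU) U'n0.
exists u => //; apply: leq_trans low; apply: deg_in_sub => v vU' uv.
by rewrite uv stuck // (subsetP sU').
Qed.

Lemma ex_removable_setU1 M U : k_removable k M -> U \subset ~: cover M ->
  ~ acyclic_on (@adj G) U -> exists M', k_removable k M' /\ #|M'| = #|M|.+1.
Proof.
move=> rM sU cyc.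
have [/existsP[x /existsP[y /and3P[xU yU rxy]]]|nex] :=
  boolP [exists x, exists y, [&& x \in U, y \in U & removable_edge M x y]].
  have [xM yM] := (subsetP sU x xU, subsetP sU y yU); rewrite !inE in xM yM.
  by exists ([set x; y] |: M); apply: removable_setU1.
case: cyc; apply: (acyclic_of_no_removable_edge rM sU) => x y xU yU.
by apply: contra nex => rxy; apply/existsP; exists x; apply/existsP; exists y; apply/and3P.
Qed.

(** At most [2 * #|M|] neighbours of a vertex are covered, so each uncovered vertex has two
    uncovered neighbours, and these vertices do not induce a forest. *)
Lemma ex_removable_succ M : k_removable k M -> 2 * #|M| + 1 < min_degree G ->
  exists M', k_removable k M' /\ #|M'| = #|M|.+1.
Proof.
move=> rM deg; have cM := card_cover_matching rM.1.
apply: (ex_removable_setU1 rM (subxx _)) => ac.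
have [|u _] := ac _ (subxx _).
  by apply: uncovered_n0; rewrite cM; apply: leq_ltn_trans deg; apply: leq_addr.
rewrite leqNgt => /negP[]; have := deg_in_uncovered M u; rewrite cM => leD.
by rewrite -(ltn_add2r (2 * #|M|)) (leq_trans _ leD) // addnC.
Qed.

Lemma ex_removable n : k_connected k G -> 2 * n <= min_degree G ->
  exists M, k_removable k M /\ #|M| = n.
Proof.
move=> kc; elim: n => [|n IH] len.
  exists set0; rewrite cards0; split=> //; split.
    by split; rewrite ?sub0set //; apply/trivIsetP=> A B; rewrite inE.
  apply/k_connectedP; rewrite (@eq_kconn _ _ _ (@adj G)); first exact/k_connectedP.
  by move=> x y; rewrite adj_del_edges // /cover big_set0 inE.
have [|M [rM cM]] := IH; first by apply: leq_trans len; rewrite leq_mul2l leqnSn orbT.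
by rewrite -cM; apply: ex_removable_succ; rewrite // cM; apply: leq_trans len; lia.
Qed.

Lemma ex_removable_add2 M : k_removable k M -> 2 * #|M| + 2 < min_degree G ->
  exists M', k_removable k M' /\ #|M'| = #|M|.+2.
Proof.
move=> rM deg; have cM := card_cover_matching rM.1.
(* A boolean form of removability makes the case distinction on larger matchings decidable. *)
pose rem M' := [&& M' \subset edges G, trivIset M' & kconn k (@adj (del_edges M'))].
have remP M' : reflect (k_removable k M') (rem M').
  apply: (iffP and3P) => [[sM tM /k_connectedP kc]|[[sM tM] /k_connectedP kc]] //.
have [/existsP[M' /andP[/remP rM' /eqP cM']]|nex] :=
  boolP [exists M', rem M' && (#|M'| == #|M|.+2)]; first by exists M'.
have {}nex M' : k_removable k M' -> #|M'| = #|M|.+2 -> False.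
  move=> /remP rM' cM'; case/negP: nex; apply/existsP; exists M'.
  by rewrite rM' cM' eqxx.
set W := ~: cover M.
have W4 : #|W| = 4.
  apply: (@card4_of_marked_acyclic _ (@adj G) (removable_edge M)).
  - exact: adj_sym.
  - exact: adj_irrefl.
  - move=> x y; rewrite /removable_edge (adj_sym x) (@critical_sym _ k) //.
    exact: (@adj_sym (del_edges M)).
  - by move=> x y /andP[].
  - by apply: uncovered_n0; rewrite cM; apply: leq_ltn_trans deg; apply: leq_addr.
  - move=> u _; have := deg_in_uncovered M u; rewrite cM => leD.
    by rewrite -(ltn_add2r (2 * #|M|)) (leq_trans _ leD) // addnC.
  - exact: removable_acyclic.
  (* Once [x y] is added to [M], [nex] forbids any further removable edge. *)
  - move=> x y; rewrite !inE => xM yM rxy.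
    have [rM1 cM1] := removable_setU1 rM xM yM rxy.
    apply: (acyclic_of_no_removable_edge rM1).
      apply/subsetP=> t; rewrite !inE cover_setU1 => /and3P[-> ->]; exact.
    move=> p q; rewrite !inE => /and3P[py px pM] /and3P[qy qx qM].
    apply/negP=> rpq; have [||rM2 cM2] := removable_setU1 rM1 _ _ rpq.
    + by rewrite cover_setU1 px py.
    + by rewrite cover_setU1 qx qy.
    + by apply: (nex _ rM2); rewrite cM2 cM1.
have cG : #|G| = 2 * #|M| + 4 by rewrite -cM -W4 cardsC.
(* The minimum degree is at least [2 * #|M| + 3], which is [#|G| - 1]. *)
have full : forall x y : G, x != y -> adj x y.
  by apply: complete_of_min_degree; rewrite cG; move: deg; clear; lia.
(* The four uncovered vertices are split into two pairs, completing [M] to a perfect matching. *)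
have /card_gt1P[x [y [xW yW xy]]] : 1 < #|W| by rewrite W4.
have W2 : #|W :\ x :\ y| = 2.
  by have := cardsD2 xW yW xy; rewrite W4; move: #|_ :\ y|; clear; lia.
have /card_gt1P[p [q []]] : 1 < #|W :\ x :\ y| by rewrite W2.
rewrite !inE => /and3P[py px pM] /and3P[qy qx qM] pq.
move: xW yW; rewrite !inE => xM yM.
have [mM1 cM1] := matching_setU1 rM.1 (full _ _ xy) xM yM.
have [||mM2 cM2] := matching_setU1 mM1 (full _ _ pq).
- by rewrite cover_setU1 px py.
- by rewrite cover_setU1 qx qy.
exists ([set p; q] |: ([set x; y] |: M)); rewrite cM2 cM1; split=> //.
apply: complete_removable => //.
exact: leq_ltn_trans (leq_trans deg_k (min_degree_le x)) (degree_lt_card x).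
Qed.

End Matchings.

(** * Complete graphs, for sharpness *)

Section CompleteGraph.
Variable n : nat.

Lemma complete_adj_sym : symmetric (fun x y : 'I_n => x != y).
Proof. by move=> x y; rewrite eq_sym. Qed.

Lemma complete_adj_irrefl : irreflexive (fun x y : 'I_n => x != y).
Proof. by move=> x; rewrite eqxx. Qed.

Definition complete_graph := SGraph complete_adj_sym complete_adj_irrefl.

Lemma complete_k_connected k : k < n -> k_connected k complete_graph.
Proof.
move=> kn; apply/k_connectedP/kconnP; split; first by rewrite card_ord.
move=> A B x y xA yB dAB /(_ x y xA yB); rewrite negbK => /eqP xy.
by rewrite xy (disjointFl dAB yB) in xA.
Qed.

Lemma min_degree_complete : n.-1 <= min_degree complete_graph.
Proof.
apply: min_degree_ge => [|x]; first by rewrite card_ord leq_pred.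
rewrite /degree (_ : [set y | _] = [set~ x]) ?cardsC1 ?card_ord //.
by apply/setP=> y; rewrite !inE eq_sym.
Qed.

End CompleteGraph.

Theorem mainTheorem2 (k m : nat) (k_gt0 : 0 < k) (m_gt0 : 0 < m) :
  guarantees_removable_matching k m (maxn (k + 1) (2 * m - 1)) /\
  (forall d : nat, guarantees_removable_matching k m d ->
     maxn (k + 1) (2 * m - 1) <= d).
Proof.
split=> [G kc | d guar].
  rewrite geq_max addn1 => /andP[deg_k deg_m].
  case: m m_gt0 deg_m => [//|[|j]] _ deg_m.
    (* For [m = 1] the required minimum degree 2 comes from [k + 1] with [k] positive. *)
    by apply: ex_removable => //; apply: leq_trans deg_k.
  have [|M [rM cM]] := @ex_removable k G deg_k j kc.
    by apply: leq_trans deg_m; lia.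
  by rewrite -cM; apply: ex_removable_add2; rewrite // cM; apply: leq_trans deg_m; lia.
rewrite leqNgt leq_max addn1 ltnS; apply/negP; have [dk _|kd /= dm] := leqP d k.
  (* In [K_(k+1)], the ends of a deleted edge are separated by the other [k - 1] vertices. *)
  have [||M [[mM /k_connectedP/kconnP[_ conn]] cM]] := guar (complete_graph k.+1).
  - exact: complete_k_connected.
  - by apply: leq_trans (min_degree_complete k.+1).
  have /card_gt0P[E EM] : 0 < #|M| by rewrite cM.
  have /edgesP[x [y [xy EE]]] := subsetP mM.1 E EM; rewrite {}EE in EM.
  have := conn [set x] [set y] x y (set11 _) (set11 _).
  rewrite disjoints1 inE (adj_neq xy) => /(_ isT) H.
  have : k <= #|~: [set x; y]|.
    by apply: H => a b /set1P-> /set1P->; rewrite /= /del_edges_adj EM andbF.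
  by rewrite -(leq_add2l #|[set x; y]|) cardsC cards2 (adj_neq xy) card_ord ltnn.
(* Here [k < d < 2m - 1], so [K_(2m-1)] is k-connected, but [m] disjoint edges need [2m]
   vertices. *)
have [||M [[mM _] cM]] := guar (complete_graph (2 * m - 1)).
- by apply: complete_k_connected; lia.
- by apply: leq_trans (min_degree_complete _); lia.
have := max_card (cover M); rewrite card_cover_matching // cM card_ord; lia.
Qed.
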